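(* Let $(S,\cdot,\ast)$ be a regular $\star$-semigroup. Define binary operations $+$ and $\oplus$ on $S$ by $a+b=aa^{\ast}b$ and $a\oplus b=ab^{\ast}b$ for all $a,b\in S$. Then the following hold. (A) The following are equivalent: (1) $(S,+)$ is a semigroup; (2) $(S,\cdot,\ast)$ is orthodox and locally inverse; (3) $x(y+z)=xy+x(x^{\ast}+z)$ for all $x,y,z\in S$. Likewise, the following are equivalent: (1') $(S,\oplus)$ is a semigroup; (2) $(S,\cdot,\ast)$ is orthodox and locally inverse; (3') $(z\oplus y)x=(z\oplus x^{\ast})x\oplus yx$ for all $x,y,z\in S$. (B) The identity $(z+y)x=(z+x^{\ast})x+yx$ holds for all $x,y,z\in S$ if and only if $(S,\cdot,\ast)$ is completely regular and locally inverse. Likewise, the identity $x(y\oplus z)=xy\oplus x(x^{\ast}\oplus z)$ holds for all $x,y,z\in S$ if and only if $(S,\cdot,\ast)$ is completely regular and locally inverse. (C) $(S,+,\cdot,\ast)$ is a left regular $\star$-semibrace if and only if $(S,\cdot,\ast)$ is orthodox and locally inverse; and $(S,+,\cdot,\ast)$ is a right (or equivalently, two-sided) regular $\star$-semibrace if and only if $(S,\cdot,\ast)$ is completely regular, orthodox and locally inverse. Likewise, $(S,\oplus,\cdot,\ast)$ is a right regular $\star$-semibrace if and only if $(S,\cdot,\ast)$ is orthodox and locally inverse; and $(S,\oplus,\cdot,\ast)$ is a left (or equivalently, two-sided) regular $\star$-semibrace if and only if $(S,\cdot,\ast)$ is completely regular, orthodox and locally inverse.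
   Context: A regular $\star$-semigroup is a triple $(S,\cdot,\ast)$ where $(S,\cdot)$ is a semigroup on a non-empty set and $\ast:S\to S$, $x\mapsto x^\ast$, satisfies $xx^\ast x=x$, $(x^\ast)^\ast=x$, $(xy)^\ast=y^\ast x^\ast$ for all $x,y\in S$. It is called completely regular if $a\,\mathcal H\,a^2$ for all $a\in S$ ($\mathcal H=\mathcal L\cap\mathcal R$ being Green's relation), orthodox if the product of any two idempotents is idempotent, and locally inverse if $eSe$ is an inverse semigroup for every idempotent $e$. Let $(S,+,\cdot,\ast)$ be such that $(S,+)$ is a semigroup and $(S,\cdot,\ast)$ is a regular $\star$-semigroup. It is a left regular $\star$-semibrace if $x(y+z)=xy+x(x^{\ast}+z)$ for all $x,y,z\in S$; a right regular $\star$-semibrace if $(z+y)x=(z+x^{\ast})x+yx$ for all $x,y,z\in S$; two-sided if both hold. Multiplication has precedence over addition. The same terminology is used with $\oplus$ in place of $+$. *)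

(* Defs.v *)
From mathcomp Require Import all_boot.

Set Implicit Arguments.
Unset Strict Implicit.
Unset Printing Implicit Defensive.

Definition semigroup (S : Type) (op : S -> S -> S) : Prop := associative op.

Section StarSemigroups.

Variables (S : Type) (mul : S -> S -> S) (star : S -> S).

Local Infix "*" := mul.

Record regular_star_semigroup : Prop := RegularStarSemigroup {
  rss_inhabited : inhabited S;
  rss_semigroup : semigroup mul;
  rss_regular : forall x, x * star x * x = x;
  rss_involutive : forall x, star (star x) = x;
  rss_antimorphism : forall x y, star (x * y) = star y * star x
}.

(* The sets S^1 a and a S^1, where S^1 is S with an identity adjoined. *)
Definition principal_left_ideal (a : S) : S -> Prop :=
  fun x => x = a \/ exists s, x = s * a.
Definition principal_right_ideal (a : S) : S -> Prop :=
  fun x => x = a \/ exists s, x = a * s.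

Definition green_L (a b : S) : Prop :=
  forall x, principal_left_ideal a x <-> principal_left_ideal b x.
Definition green_R (a b : S) : Prop :=
  forall x, principal_right_ideal a x <-> principal_right_ideal b x.
Definition green_H (a b : S) : Prop := green_L a b /\ green_R a b.

Definition completely_regular : Prop := forall a, green_H a (a * a).

Definition is_idempotent (e : S) : Prop := e * e = e.

Definition orthodox : Prop :=
  forall e f, is_idempotent e -> is_idempotent f -> is_idempotent (e * f).

Definition is_inverse (x y : S) : Prop := x * y * x = x /\ y * x * y = y.

(* The subset A, with the multiplication restricted from S, is an inverse
   semigroup: every element of A has exactly one inverse in A. *)
Definition inverse_subsemigroup (A : S -> Prop) : Prop :=
  (forall x y, A x -> A y -> A (x * y)) /\
  (forall x, A x -> exists! y, A y /\ is_inverse x y).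

(* The set e S e. *)
Definition local_subsemigroup (e : S) : S -> Prop :=
  fun x => exists s, x = e * s * e.

Definition locally_inverse : Prop :=
  forall e, is_idempotent e -> inverse_subsemigroup (local_subsemigroup e).

Definition star_plus (a b : S) : S := a * star a * b.
Definition star_oplus (a b : S) : S := a * star b * b.

End StarSemigroups.

Section Semibraces.

Variables (S : Type) (add mul : S -> S -> S) (star : S -> S).

Local Infix "+" := add.
Local Infix "*" := mul.

Definition left_semibrace_law : Prop :=
  forall x y z, x * (y + z) = x * y + x * (star x + z).

Definition right_semibrace_law : Prop :=
  forall x y z, (z + y) * x = (z + star x) * x + y * x.

Definition left_regular_star_semibrace : Prop :=
  [/\ semigroup add, regular_star_semigroup mul star & left_semibrace_law].

Definition right_regular_star_semibrace : Prop :=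
  [/\ semigroup add, regular_star_semigroup mul star & right_semibrace_law].

Definition two_sided_regular_star_semibrace : Prop :=
  left_regular_star_semibrace /\ right_regular_star_semibrace.

End Semibraces.

(* Main.v *)
(** Every idempotent of a regular star-semigroup is a product of two
    projections (self-adjoint idempotents), and the projections are exactly the
    elements [a a*].  All the identities of the statement then reduce to two
    conditions on projections:
    - [pqz = pqpz] for associativity and for the semibrace law on the same side
      as the operation; it amounts to [S] being orthodox and locally inverse;
    - [pyq = pqpyq] for the semibrace law on the opposite side; it amounts to
      [S] being completely regular and locally inverse.
    Both conditions are invariant under the star, so they serve [+] and [oplus]
    alike. *)
Require Import Defs.
From mathcomp Require Import all_boot.

Section RegularStarSemigroup.

Variables (S : Type) (mul : S -> S -> S) (star : S -> S).
Hypothesis hS : regular_star_semigroup mul star.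

Local Infix "*" := mul.
Local Notation "x ^*" := (star x).
Local Notation idem := (is_idempotent mul).

Let mulA : associative mul := rss_semigroup hS.
Let mulsK : forall x, x * x^* * x = x := rss_regular hS.
Let starK : forall x, x^*^* = x := rss_involutive hS.
Let starM : forall x y, (x * y)^* = y^* * x^* := rss_antimorphism hS.

(** * Projections and idempotents *)

Definition projection (p : S) : Prop := p * p = p /\ p^* = p.

Lemma projection_mul_star x : projection (x * x^*).
Proof. by split; rewrite ?starM ?starK // mulA mulsK. Qed.

Lemma projection_star_mul x : projection (x^* * x).
Proof. by rewrite -{2}[x]starK; exact: projection_mul_star. Qed.

Lemma star_mulsK x : x^* * x * x^* = x^*.
Proof. by rewrite -{2}[x]starK mulsK. Qed.

Lemma projection_mul_starE {p} : projection p -> p * p^* = p.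
Proof. by case=> pp ->. Qed.

Lemma projection_star_mulE {p} : projection p -> p^* * p = p.
Proof. by case=> pp ->. Qed.

Lemma projection_idem {p} : projection p -> idem p.
Proof. by case. Qed.

(** Since [star (p * q) = q * p], regularity of [p * q] reads [pq.qp.pq = pq], that is,
    [pqpq = pq]. *)
Lemma idem_mul_projection p q : projection p -> projection q -> idem (p * q).
Proof.
move=> [pp ps] [qq qs]; have := mulsK (p * q).
rewrite starM ps qs !mulA -[p * q * q]mulA qq -[p * q * p * p]mulA pp.
by rewrite /is_idempotent !mulA.
Qed.

(** Put [star e = star (e * e) = star e * star e] into [e = e * star e * e]. *)
Lemma idem_projections {e} : idem e -> (e * e^*) * (e^* * e) = e.
Proof.
by move=> ee; rewrite -[RHS]mulsK -{6}[e]ee starM !mulA.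
Qed.

Lemma idem_star {e} : idem e -> idem e^*.
Proof. by rewrite /is_idempotent -starM => ->. Qed.

(** * Local subsemigroups and inverses within them *)

Lemma mem_local {e x} : idem e ->
  local_subsemigroup mul e x <-> e * x = x /\ x * e = x.
Proof.
move=> ee; split=> [[s ->]|[ex xe]]; last by exists x; rewrite ex xe.
by split; rewrite ?mulA ?ee // -mulA ee.
Qed.

Lemma inverse_uniq {e x y z} : locally_inverse mul -> idem e ->
    e * x = x /\ x * e = x -> e * y = y /\ y * e = y ->
    e * z = z /\ z * e = z ->
  is_inverse mul x y -> is_inverse mul x z -> y = z.
Proof.
move=> li ee lx ly lz xy xz.
have [_ /(_ x)] := li e ee.
case; first exact/mem_local.
move=> w [_ uw]; transitivity w; [symmetry|]; apply: uw; split=> //;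
  exact/mem_local.
Qed.

(** Compressing [star x] to [e * star x * e] keeps it an inverse of [x]; local inversity thus only
    concerns uniqueness. *)
Lemma inverse_exists {e x} : idem e -> e * x = x /\ x * e = x ->
  exists y, (e * y = y /\ y * e = y) /\ is_inverse mul x y.
Proof.
move=> ee [ex xe]; exists (e * x^* * e); split.
  by split; rewrite ?mulA ?ee // -mulA ee.
split; first by rewrite !mulA xe -mulA ex mulsK.
have -> : e * x^* * e * x * (e * x^* * e) = e * (x^* * (e * x * e) * x^*) * e.
  by rewrite !mulA.
by rewrite ex xe star_mulsK.
Qed.

Lemma local_idem_comm e u v : locally_inverse mul -> idem e ->
    e * u = u /\ u * e = u -> e * v = v /\ v * e = v -> idem u -> idem v ->
  u * v = v * u.
Proof.
(* First, products of idempotents of [eSe] are idempotent. If [w] is the inverse of [ab], so is the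
   idempotent [bwa], hence [w = bwa]. An idempotent is its own inverse, so [ab = w]. Then [uv] and
   [vu] are both inverses of [uv], hence equal. *)
move=> li ee; have idem_uv a b : e * a = a /\ a * e = a ->
    e * b = b /\ b * e = b -> idem a -> idem b -> idem (a * b).
  move=> [ea ae] [eb be] aa bb.
  have lab : e * (a * b) = a * b /\ a * b * e = a * b.
    by rewrite mulA ea -mulA be.
  have [w [lw [xwx wxw]]] := inverse_exists ee lab.
  have [ew we] := lw.
  have bwaE : b * w * a * (b * w * a) = b * w * a.
    have -> : b * w * a * (b * w * a) = b * (w * (a * b) * w) * a.
      by rewrite !mulA.
    by rewrite wxw.
  have wE : b * w * a = w.
    apply: (inverse_uniq li ee lab) => //.
      by rewrite -mulA mulA eb -!mulA ae.
    split.
      have -> : a * b * (b * w * a) * (a * b) = a * (b * b) * w * (a * a) * b.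
        by rewrite !mulA.
      by rewrite aa bb -[RHS]xwx !mulA.
    have -> : b * w * a * (a * b) * (b * w * a)
        = b * (w * ((a * a) * (b * b)) * w) * a by rewrite !mulA.
    by rewrite aa bb wxw.
  have ww : w * w = w by rewrite -wE.
  suff -> : a * b = w by [].
  by apply: (inverse_uniq li ee lw) => //; split; rewrite // ww.
move=> lu lv uu vv; have [eu ue] := lu; have [ev ve] := lv.
have luv : e * (u * v) = u * v /\ u * v * e = u * v.
  by rewrite mulA eu -mulA ve.
have iuv := idem_uv _ _ lu lv uu vv; have ivu := idem_uv _ _ lv lu vv uu.
apply: (inverse_uniq li ee luv) => //.
- by rewrite mulA ev -mulA ue.
- by split; rewrite iuv.
split.
  have -> : u * v * (v * u) * (u * v) = u * (v * v) * (u * u) * v.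
    by rewrite !mulA.
  by rewrite uu vv -[RHS]iuv !mulA.
have -> : v * u * (u * v) * (v * u) = v * (u * u) * (v * v) * u.
  by rewrite !mulA.
by rewrite uu vv -[RHS]ivu !mulA.
Qed.

(* [x |-> x f] with [f = e e*] is an isomorphism of [eSe] onto [fSf], so it is
   enough to look at [pSp] for projections [p]; there idempotents are products
   of two projections below [p]. *)
Lemma locally_inverse_of_projections :
    (forall p g h, projection p -> projection g -> projection h ->
      p * g = g -> p * h = h -> g * h = h * g) ->
  locally_inverse mul.
Proof.
move=> comm_proj.
have local_projection p u : projection p -> p * u = u -> u * p = u -> idem u ->
    projection u.
  move=> pP pu up uu; split=> //.
  (* Both [u] and [star u] are products of the projections [u * star u] and [star u * u], in
     opposite orders. These lie below [p], so they commute and [star u = u]. *)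
  have us : u^* * u * (u * u^*) = u^*.
    by have := idem_projections (idem_star uu); rewrite starK.
  rewrite -{2}(idem_projections uu) -{1}us.
  apply: (comm_proj p); rewrite ?mulA ?pu //.
  - exact: projection_star_mul.
  - exact: projection_mul_star.
  by case: pP => _ <-; rewrite -starM up.
have comm e u v : idem e -> e * u = u /\ u * e = u -> e * v = v /\ v * e = v ->
    idem u -> idem v -> u * v = v * u.
  move=> ee [eu ue] [ev ve] uu vv; pose f := e * e^*.
  have fP : projection f by exact: projection_mul_star.
  have fe : f * e = e by exact: mulsK.
  clearbody f.
  have fl x : e * x = x -> f * x = x by move=> ex; rewrite -ex mulA fe.
  have ff : f * f = f by case: fP.
  have fidem x : e * x = x -> idem x -> projection (x * f).
    move=> ex xx; apply: (local_projection f) => //.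
    - by rewrite mulA fl.
    - by rewrite -mulA ff.
    by rewrite /is_idempotent mulA -[x * f * x]mulA fl // xx.
  (* [uf] and [vf] are projections below [f], so they commute; multiplying by [e] on the right
     removes [f], because [fe = e]. *)
  have := comm_proj f (u * f) (v * f) fP (fidem _ eu uu) (fidem _ ev vv).
  rewrite !mulA !fl // -(mulA u) -(mulA v) !fl // => /(_ erefl erefl).
  by move=> /(congr1 (mul^~ e)); rewrite -!mulA fe ue ve.
move=> e ee; split=> [x y /(mem_local ee)[ex xe] /(mem_local ee)[ey ye]|x].
  by apply/(mem_local ee); rewrite mulA ex -mulA ye.
move=> /(mem_local ee) lx; have [y [ly [xyx yxy]]] := inverse_exists ee lx.
exists y; split=> [|z [/(mem_local ee) lz [xzx zxz]]].
  by split=> //; exact/(mem_local ee).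
have [ex xe] := lx; have [ey ye] := ly; have [ez ze] := lz.
have prod a b : e * a = a -> b * e = b -> e * (a * b) = a * b /\ a * b * e = a * b.
  by move=> ea be; rewrite mulA ea -mulA be.
have cl : x * y * (x * z) = x * z * (x * y).
  apply: (comm e) => //; try exact: prod.
    by rewrite /is_idempotent mulA xyx.
  by rewrite /is_idempotent mulA xzx.
have cr : y * x * (z * x) = z * x * (y * x).
  apply: (comm e) => //; try exact: prod.
    by rewrite /is_idempotent mulA yxy.
  by rewrite /is_idempotent mulA zxz.
(* [y = y(xz)(xy) = y(xy)(xz) = yxz] and [z = (zx)(yx)z = (yx)(zx)z = yxz]. *)
transitivity (y * x * z).
  rewrite -{1}yxy -{1}xzx.
  have -> : y * (x * z * x) * y = y * (x * z * (x * y)) by rewrite !mulA.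
  by rewrite -cl !mulA yxy.
rewrite -[RHS]zxz -{2}xyx.
have -> : z * (x * y * x) * z = z * x * (y * x) * z by rewrite !mulA.
by rewrite -cr -!mulA [z * (x * z)]mulA zxz.
Qed.

(** * The absorption conditions and the identities equivalent to them *)

Definition left_absorption : Prop := forall p q z,
  projection p -> projection q -> p * q * z = p * q * p * z.

Definition two_sided_absorption : Prop := forall p q y,
  projection p -> projection q -> p * y * q = p * q * p * y * q.

Lemma left_absorption_dual : left_absorption <->
  forall p q z, projection p -> projection q -> z * q * p = z * p * q * p.
Proof.
by split=> H p q z pP qP; have := H p q z^* pP qP; case: (pP) (qP) => _ ps [_ qs];
  move=> /(congr1 star); rewrite !starM !starK ?ps ?qs !mulA.
Qed.

Lemma two_sided_absorption_dual : two_sided_absorption <->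
  forall p q y, projection p -> projection q ->
    q * y * p = q * y * p * q * p.
Proof.
by split=> H p q y pP qP; have := H p q y^* pP qP; case: (pP) (qP) => _ ps [_ qs];
  move=> /(congr1 star); rewrite !starM !starK ?ps ?qs !mulA.
Qed.

(** With [p = x * star x] and [q = y * star y], the two bracketings are [pqz] and [pqpz]; every
    projection [p] arises as [p * star p]. *)
Lemma semigroup_plusE : semigroup (star_plus mul star) <-> left_absorption.
Proof.
rewrite /star_plus; split=> [addA p q z pP qP|H x y z].
  have [pp ps] := pP; have [qq qs] := qP; have := addA p q z.
  by rewrite !starM !ps !qs !mulA !pp -!(mulA _ q q) !qq -!(mulA _ p p) !pp.
have := H _ _ z (projection_mul_star x) (projection_mul_star y).
by rewrite !starM starK !mulA.
Qed.

Lemma semigroup_oplusE : semigroup (star_oplus mul star) <-> left_absorption.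
Proof.
apply: (iff_trans _ (iff_sym left_absorption_dual)).
rewrite /star_oplus; split=> [addA p q z pP qP|H x y z].
  have := addA z q p.
  have [pp ps] := pP; have [qq qs] := qP.
  rewrite !starM !ps !qs !mulA -!(mulA _ q q) !qq -!(mulA _ p p) !pp.
  by move=> ->.
have := H _ _ x (projection_star_mul z) (projection_star_mul y).
by rewrite !starM starK !mulA.
Qed.

(** With [p = star x * x] and [q = y * star y], the law reads [xqz = xqpz]. This is absorption
    multiplied by [x] on the left, as [xp = x]. *)
Lemma left_law_plusE :
  left_semibrace_law (star_plus mul star) mul star <-> left_absorption.
Proof.
have lawE x y z : (x * y) * (x * y)^* * (x * (x^* * x^*^* * z))
    = x * (y * y^*) * x^* * x * z.
  have -> : (x * y) * (x * y)^* * (x * (x^* * x^*^* * z))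
      = x * (y * y^*) * x^* * (x * x^* * x) * z by rewrite starM starK !mulA.
  by rewrite mulsK.
rewrite /left_semibrace_law /star_plus; split=> [H p q z pP qP|H x y z].
  have := H p q z; rewrite lawE (projection_mul_starE qP); case: pP => pp ->.
  by rewrite mulA -(mulA _ p p) pp.
rewrite lawE; have := H _ _ z (projection_star_mul x) (projection_mul_star y).
by move=> /(congr1 (mul x)); rewrite !mulA mulsK => ->.
Qed.

Lemma right_law_oplusE :
  right_semibrace_law (star_oplus mul star) mul star <-> left_absorption.
Proof.
have lawE x y z : (z * x^*^* * x^* * x) * (y * x)^* * (y * x)
    = z * x * x^* * (y^* * y) * x.
  have -> : (z * x^*^* * x^* * x) * (y * x)^* * (y * x)
      = z * (x * x^* * x) * x^* * (y^* * y) * x by rewrite starM starK !mulA.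
  by rewrite mulsK.
apply: (iff_trans _ (iff_sym left_absorption_dual)).
rewrite /right_semibrace_law /star_oplus.
split=> [H p q z pP qP|H x y z].
  have := H p q z; rewrite lawE -(mulA z) (projection_star_mulE qP).
  by case: pP => pp ->; rewrite -(mulA _ p p) pp.
rewrite lawE; have := H _ _ z (projection_mul_star x) (projection_star_mul y).
move=> /(congr1 (mul^~ x)); rewrite !mulA -!(mulA _ x x^*) -!(mulA _ (x * x^*) x).
by rewrite mulsK !mulA.
Qed.

(** With [p = z * star z] and [q = star x * x], the law reads [pyx = pqpyx]. It is absorption at
    [y * x], as [xq = x]. *)
Lemma right_law_plusE :
  right_semibrace_law (star_plus mul star) mul star <-> two_sided_absorption.
Proof.
have lawE x y z : (z * z^* * x^* * x) * (z * z^* * x^* * x)^* * (y * x)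
    = (z * z^*) * (x^* * x) * (z * z^*) * y * x.
  have -> : (z * z^* * x^* * x) * (z * z^* * x^* * x)^* * (y * x)
      = (z * z^*) * (x^* * x * (x^* * x)) * (z * z^*) * y * x.
    by rewrite !starM !starK !mulA.
  by case: (projection_star_mul x) => ->.
rewrite /right_semibrace_law /star_plus; split=> [H p q y pP qP|H x y z].
  have := H q y p.
  by rewrite lawE (projection_mul_starE pP) (projection_star_mulE qP).
rewrite lawE.
have := H _ _ (y * x) (projection_mul_star z) (projection_star_mul x).
by rewrite !mulA -!(mulA _ x x^*) -!(mulA _ (x * x^*) x) mulsK.
Qed.

Lemma left_law_oplusE :
  left_semibrace_law (star_oplus mul star) mul star <-> two_sided_absorption.
Proof.
have lawE x y z : (x * y) * (x * (x^* * z^* * z))^* * (x * (x^* * z^* * z))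
    = x * y * (z^* * z) * (x * x^*) * (z^* * z).
  have -> : (x * y) * (x * (x^* * z^* * z))^* * (x * (x^* * z^* * z))
      = x * y * (z^* * z) * ((x * x^*) * (x * x^*)) * (z^* * z).
    by rewrite !starM !starK !mulA.
  by case: (projection_mul_star x) => ->.
apply: (iff_trans _ (iff_sym two_sided_absorption_dual)).
rewrite /left_semibrace_law /star_oplus.
split=> [H p q y pP qP|H x y z].
  have := H q y p.
  by rewrite lawE (projection_mul_starE qP) -(mulA y) (projection_star_mulE pP)
    mulA.
rewrite lawE.
have := H _ _ (x * y) (projection_star_mul z) (projection_mul_star x).
by rewrite !mulA mulsK.
Qed.

(** * Orthodox locally inverse semigroups and left absorption *)

Lemma inverse_mul x x' y y' : orthodox mul ->
  is_inverse mul x x' -> is_inverse mul y y' ->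
  is_inverse mul (x * y) (y' * x').
Proof.
move=> od [xx'x x'xx'] [yy'y y'yy'].
have ixx' : idem (x' * x) by rewrite /is_idempotent mulA x'xx'.
have iyy' : idem (y * y') by rewrite /is_idempotent mulA yy'y.
split.
  have -> : x * y * (y' * x') * (x * y) = x * (y * y' * (x' * x)) * y.
    by rewrite !mulA.
  (* Padding with [x'x] and [yy'] turns the middle factor into the square of the idempotent
     [x'x.yy']. *)
  rewrite -{1}xx'x -{2}yy'y.
  have -> : x * x' * x * (y * y' * (x' * x)) * (y * y' * y)
      = x * (x' * x * (y * y') * (x' * x * (y * y'))) * y by rewrite !mulA.
  by rewrite od // !mulA xx'x -!mulA [y * (y' * y)]mulA yy'y.
have -> : y' * x' * (x * y) * (y' * x') = y' * (x' * x * (y * y')) * x'.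
  by rewrite !mulA.
rewrite -{1}y'yy' -{2}x'xx'.
have -> : y' * y * y' * (x' * x * (y * y')) * (x' * x * x')
    = y' * (y * y' * (x' * x) * (y * y' * (x' * x))) * x' by rewrite !mulA.
by rewrite od // !mulA y'yy' -!mulA [x' * (x * x')]mulA x'xx'.
Qed.

(* In an orthodox semigroup [e(gf)e] is an inverse of the idempotent [e(fg)e],
   which is its own inverse too. *)
Lemma idem_normal {e f g} : orthodox mul -> locally_inverse mul ->
  idem e -> idem f -> idem g -> e * f * g * e = e * g * f * e.
Proof.
move=> od li ee ff gg.
have loc x : e * (e * x * e) = e * x * e /\ e * x * e * e = e * x * e.
  by rewrite !mulA ee -!mulA ee.
have self_inverse x : idem x -> is_inverse mul x x.
  by move=> xx; split; rewrite xx.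
have ie := self_inverse e ee.
have := inverse_uniq li ee (loc (f * g)) (loc (f * g)) (loc (g * f)).
rewrite !mulA; apply; first by apply: self_inverse; do 3!apply: (od) => //.
have := inverse_mul _ _ _ _ od (inverse_mul _ _ _ _ od ie (inverse_mul _ _ _ _ od
  (self_inverse f ff) (self_inverse g gg))) ie.
by rewrite !mulA.
Qed.

Lemma left_absorptionE :
  left_absorption <-> orthodox mul /\ locally_inverse mul.
Proof.
split=> [H|[od li] p q z pP qP].
  have H' := proj1 left_absorption_dual H; split.
    (* A product of projections is their [star_plus]-sum, and every element is
       idempotent for [star_plus]. *)
    move=> e f ee ff.
    have addA := proj2 semigroup_plusE H.
    have addE p x : projection p -> star_plus mul star p x = p * x.
      by move=> pP; rewrite /star_plus projection_mul_starE.
    have [pe qe] := (projection_mul_star e, projection_star_mul e).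
    have [pf qf] := (projection_mul_star f, projection_star_mul f).
    pose w := star_plus mul star (e * e^*) (star_plus mul star (e^* * e)
      (star_plus mul star (f * f^*) (f^* * f))).
    have wE : w = e * f.
      by rewrite /w !addE // (idem_projections ff) mulA (idem_projections ee).
    have ww : star_plus mul star w w = w by exact: mulsK.
    move: ww; rewrite {1}/w -!addA !addE // wE.
    rewrite [X in _ * (_ * X)]mulA (idem_projections ff).
    by rewrite mulA (idem_projections ee) mulA.
  apply: locally_inverse_of_projections => p g h pP gP hP pg ph.
  have hp : h * p = h by case: (pP) (hP) => _ <- [_ <-]; rewrite -starM ph.
  have gp : g * p = g by case: (pP) (gP) => _ <- [_ <-]; rewrite -starM pg.
  (* Absorption with [p] as the third factor gives [hg = hgh]; its dual gives [gh = hgh]. *)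
  have := H h g p hP gP; rewrite -!mulA gp hp => ->.
  by have := H' h g p hP gP; rewrite pg ph mulA.
have ip := projection_idem pP; have iq := projection_idem qP.
have ir := projection_idem (projection_mul_star z).
(* Writing [z] as [(z * star z) * z] reduces the claim to an idempotent [r] in place of [z]. *)
rewrite -[in LHS](mulsK z) -[in RHS](mulsK z).
move: (z * z^*) ir => r ir.
rewrite !mulA; congr (_ * z).
have iqp : idem (q * p) by exact: od.
have irp : idem (r * p) by exact: od.
have pqr : idem (p * q * r) by do 2!apply: (od) => //.
have pqpr : idem (p * q * p * r) by do 3!apply: (od) => //.
(* Squaring [pqpr] makes room for [idem_normal], which permutes factors between two copies of [r] or
   of [q], until [(pqr)(pqr)] remains. *)
rewrite -[RHS]pqpr.
transitivity (p * q * p * (r * p * (q * p) * r)); last by rewrite !mulA.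
rewrite (idem_normal od li ir ip iqp).
transitivity (p * q * p * (r * q * (p * p) * r)); last by rewrite !mulA.
rewrite ip (idem_normal od li ir iq ip).
transitivity (p * (q * p * (r * p) * q) * r); last by rewrite !mulA.
rewrite (idem_normal od li iq ip irp).
transitivity (p * (q * r * (p * p) * q) * r); last by rewrite !mulA.
by rewrite ip -[LHS]pqr !mulA.
Qed.

(** * Complete regularity and two-sided absorption *)

Lemma completely_regularP : completely_regular mul <->
  forall a, (exists s, a = s * (a * a)) /\ (exists t, a = a * a * t).
Proof.
split=> [H a|H a].
  have [/(_ a)[La _] /(_ a)[Ra _]] := H a; split.
    (* If [a = a * a], then [a] itself serves as multiplier. *)
    by case: La => [|aE|//]; [left | exists a; rewrite -aE].
  by case: Ra => [|aE|//]; [left | exists a; rewrite -!aE].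
have [[s sE] [t tE]] := H a; split=> x; split.
- by case=> [->|[u ->]]; right; [exists s | exists (u * s); rewrite -mulA -sE].
- by case=> [->|[u ->]]; right; [exists a | exists (u * a); rewrite mulA].
- by case=> [->|[u ->]]; right; [exists t | exists (t * u); rewrite mulA -tE].
- by case=> [->|[u ->]]; right; [exists a | exists (a * u); rewrite mulA].
Qed.

Lemma two_sided_absorptionE :
  two_sided_absorption <-> completely_regular mul /\ locally_inverse mul.
Proof.
split=> [H|[/completely_regularP cr li] p q y pP qP].
  have H' := proj1 two_sided_absorption_dual H; split.
    apply/completely_regularP => a.
    have [P Q] := (projection_mul_star a, projection_star_mul a).
    have aE : a * a^* * a * (a^* * a) = a by rewrite mulsK mulA mulsK.
    (* Absorption on [a = PaQ] gives [a = PQa], and its dual [a = aPQ]; expanding [P] and [Q] yields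
       the witnesses. *)
    split; [exists (a * a^* * a^*)|exists (a^* * a^* * a)].
      have := H _ _ a P Q.
      have -> : a * a^* * (a^* * a) * (a * a^*) * a * (a^* * a)
        = a * a^* * (a^* * a) * (a * a^* * a * (a^* * a)) by rewrite !mulA.
      by rewrite aE => {1}->; rewrite !mulA.
    by have := H' _ _ a Q P; rewrite aE => {1}->; rewrite !mulA.
  apply: locally_inverse_of_projections => p g h pP gP hP pg ph.
  have gp : g * p = g by case: (pP) (gP) => _ <- [_ <-]; rewrite -starM pg.
  have hp : h * p = h by case: (pP) (hP) => _ <- [_ <-]; rewrite -starM ph.
  (* The condition gives [hg = ghg], and its dual [gh = ghg]. *)
  have := H p g h pP gP; rewrite pg ph gp => ->.
  have := H' p g h pP gP; rewrite -!(mulA g h) hp -!(mulA _ g p) gp => ->.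
  by rewrite mulA.
(* The identity element [e] of the group H-class of [p y q] lies in [pSq]. *)
set a := p * y * q.
have [pp _] := pP; have [qq _] := qP.
have pa : p * a = a by rewrite /a !mulA pp.
have aq : a * q = a by rewrite /a -mulA qq.
have [[s sE] [t tE]] := cr a; pose e := s * a.
have eE : e = a * t by rewrite /e {1}tE mulA -sE.
have ea : e * a = a by rewrite /e -mulA -sE.
have ee : idem e by rewrite /is_idempotent {2}eE mulA ea -eE.
have pe : p * e = e by rewrite eE mulA pa.
have eq : e * q = e by rewrite /e -mulA aq.
have iep : idem (e * p) by rewrite /is_idempotent mulA -(mulA e p) pe ee.
have ipqp : idem (p * q * p).
  have := idem_mul_projection p q pP qP; rewrite /is_idempotent => pqpq.
  by rewrite -(mulA _ p) !mulA -(mulA _ p p) pp -(mulA _ p) pqpq.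
(* Both factors are idempotents of [pSp]. As [e = eq] and [qp] is idempotent, [ep.pqp = ep];
   commuting them gives [pqp.e = e], whence [pqp.a = a], which is the claim. *)
have comm : e * p * (p * q * p) = p * q * p * (e * p).
  apply: (local_idem_comm p) => //; first by rewrite mulA pe -mulA pp.
  by rewrite !mulA pp -(mulA _ p p) pp.
have ep_pqp : e * p * (p * q * p) = e * p.
  have qpqp : q * p * (q * p) = q * p by exact: idem_mul_projection.
  rewrite !mulA -(mulA e p p) pp -{1}eq.
  have -> : e * q * p * q * p = e * (q * p * (q * p)) by rewrite !mulA.
  by rewrite qpqp mulA eq.
have pqp_e : p * q * p * e = e.
  have := congr1 (mul^~ e) comm.
  by rewrite ep_pqp -mulA pe ee -(mulA _ (e * p)) -(mulA e p) pe ee.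
transitivity (p * q * p * e * a); first by rewrite pqp_e ea.
by rewrite -(mulA _ e) ea /a !mulA -(mulA _ p p) pp.
Qed.

End RegularStarSemigroup.

Theorem proposition3p8 (S : Type) (mul : S -> S -> S) (star : S -> S)
    (hS : regular_star_semigroup mul star) :
  let add := star_plus mul star in
  let oplus := star_oplus mul star in
  (* (A) *)
  (([<-> semigroup add;
         orthodox mul /\ locally_inverse mul;
         left_semibrace_law add mul star]) /\
   ([<-> semigroup oplus;
         orthodox mul /\ locally_inverse mul;
         right_semibrace_law oplus mul star])) /\
  (* (B) *)
  ((right_semibrace_law add mul star <->
      completely_regular mul /\ locally_inverse mul) /\
   (left_semibrace_law oplus mul star <->
      completely_regular mul /\ locally_inverse mul)) /\
  (* (C) *)
  ((left_regular_star_semibrace add mul star <->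
      orthodox mul /\ locally_inverse mul) /\
   ([<-> right_regular_star_semibrace add mul star;
         two_sided_regular_star_semibrace add mul star;
         [/\ completely_regular mul, orthodox mul & locally_inverse mul]]) /\
   (right_regular_star_semibrace oplus mul star <->
      orthodox mul /\ locally_inverse mul) /\
   ([<-> left_regular_star_semibrace oplus mul star;
         two_sided_regular_star_semibrace oplus mul star;
         [/\ completely_regular mul, orthodox mul & locally_inverse mul]])).
Proof.
move=> add oplus.
have [semi_add semi_oplus] := (semigroup_plusE _ _ _ hS, semigroup_oplusE _ _ _ hS).
have [left_add right_oplus] := (left_law_plusE _ _ _ hS, right_law_oplusE _ _ _ hS).
have [right_add left_oplus] := (right_law_plusE _ _ _ hS, left_law_oplusE _ _ _ hS).
have [lE tE] := (left_absorptionE _ _ _ hS, two_sided_absorptionE _ _ _ hS).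
rewrite /two_sided_regular_star_semibrace /left_regular_star_semibrace.
rewrite /right_regular_star_semibrace /add /oplus.
split; [|split]; [split; tfae|split|split; [|split; [|split]]]; try tfae.
all: try tauto.
1,5: by split=> [[]|?]; [|split]; tauto.
- by case=> *; split; split; tauto.
- by case=> [[? _ _] [_ _ ?]]; split; tauto.
- by case=> *; split; tauto.
- by case=> *; split; split; tauto.
- by case=> [[_ _ ?] [? _ _]]; split; tauto.
- by case=> *; split; tauto.
Qed.
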